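(* For any partition $\lambda$ with conjugate $\lambda'$, we have $\lambda\in\overline{\mathfrak{EO}}$ if and only if $\lambda'\in\overline{\mathfrak{EO}}$. In this case, $$\mathrm{eoc}(\lambda)=\mathcal{O}(\lambda')-\mathcal{O}(\lambda)=-\mathrm{srank}(\lambda).$$
   Context: A partition is a finite weakly decreasing sequence of positive integers (its parts); the empty partition $\epsilon$ of $0$ is allowed. The conjugate $\lambda'$ is obtained by transposing the Ferrers graph of $\lambda$. $\mathcal{O}(\lambda)$ denotes the number of odd parts of $\lambda$, counted with multiplicity. The Stanley rank is $\mathrm{srank}(\lambda)=\mathcal{O}(\lambda)-\mathcal{O}(\lambda')$. $\mathfrak{EO}$ is the set of partitions in which every even part is less than each odd part (a condition that holds vacuously if all parts have the same parity, or if the partition is empty). $\overline{\mathfrak{EO}}$ is the set of $\lambda\in\mathfrak{EO}$ in which only the largest even part, if any, appears an odd number of times: if $\lambda$ has an even part, then its largest even part has odd multiplicity, and every other part size that occurs has even multiplicity; if $\lambda$ has no even part, every part size that occurs has even multiplicity. The empty partition belongs to $\overline{\mathfrak{EO}}$. The even-odd crank of $\lambda\in\mathfrak{EO}$ is $\mathrm{eoc}(\lambda)=(\text{the largest even part of }\lambda)-\mathcal{O}(\lambda)$, where the largest even part is taken to be $0$ if $\lambda$ has no even parts. *)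

(* Defs.v *)
From mathcomp Require Import all_boot all_order all_algebra.

Set Implicit Arguments.
Unset Strict Implicit.
Unset Printing Implicit Defensive.

Definition is_intpart (s : seq nat) : bool := sorted geq s && (0 \notin s).

Record intpart : Type :=
  IntPart { parts :> seq nat; intpartP : is_intpart parts }.

(* Cells of the Ferrers graph: row i has cells in the columns j < i-th part
   (rows and columns are numbered from 0). *)
Definition ferrers (s : seq nat) (i j : nat) : bool := j < nth 0 s i.

(* The j-th entry is the length of the j-th column of the Ferrers graph of s;
   [ferrers_conj] below says that this transposes the graph. *)
Definition conj_seq (s : seq nat) : seq nat :=
  mkseq (fun j => count (fun x => j < x) s) (head 0 s).

Lemma is_intpart_conj (s : seq nat) : is_intpart s -> is_intpart (conj_seq s).
Proof.
move=> _; apply/andP; split.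
  apply/(sortedP 0) => i; rewrite size_mkseq => lt_i.
  rewrite !nth_mkseq ?(ltnW lt_i) //.
  by apply: sub_count => x /= /ltnW.
apply/negP => /mapP[j]; rewrite mem_iota add0n => /andP[_ lt_j] /esym/eqP.
by case: s lt_j => //= x s ->.
Qed.

Definition conjugate (la : intpart) : intpart :=
  IntPart (is_intpart_conj (intpartP la)).

Lemma count_gt_sorted (s : seq nat) (i j : nat) :
  sorted geq s -> (i < count (fun x => j < x) s) = (j < nth 0 s i).
Proof.
elim: s i => [|x s IHs] i /=; first by rewrite nth_nil.
rewrite (path_sortedE (rev_trans leq_trans)) => /andP[/allP le_x srt_s].
case: i => [|i] /=; first last.
  rewrite -IHs //; case: (ltnP j x) => [_|le_xj]; first by rewrite add1n.
  suff /eqP-> : count (fun y => j < y) s == 0 by [].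
  rewrite -leqn0 leqNgt -has_count; apply/hasPn => y /le_x le_yx.
  by rewrite -leqNgt (leq_trans le_yx).
case: (ltnP j x) => //= le_xj; rewrite add0n -has_count.
apply/negbTE/hasPn => y /le_x le_yx.
by rewrite -leqNgt (leq_trans le_yx).
Qed.

Lemma ferrers_conj (la : intpart) (i j : nat) :
  ferrers (conjugate la) i j = ferrers la j i.
Proof.
case: la => s /= /andP[srt_s _]; rewrite /ferrers /=.
have [lt_i|le_i] := ltnP i (head 0 s).
  by rewrite nth_mkseq // count_gt_sorted.
rewrite (nth_default 0 (s := conj_seq s)) ?size_mkseq // ltn0; symmetry.
rewrite -count_gt_sorted //; apply/negbTE; rewrite -leqNgt.
suff /eqP-> : count (fun y => i < y) s == 0 by [].
case: s srt_s le_i => //= x s.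
rewrite (path_sortedE (rev_trans leq_trans)) => /andP[/allP le_x _] le_xi.
rewrite ltnNge le_xi add0n -leqn0 leqNgt -has_count.
by apply/hasPn => y /le_x le_yx; rewrite -leqNgt (leq_trans le_yx).
Qed.

Definition num_odd (la : intpart) : nat := count odd la.

Definition srank (la : intpart) : int :=
  ((num_odd la)%:Z - (num_odd (conjugate la))%:Z)%R.

Definition has_even (la : intpart) : bool := has (fun x => ~~ odd x) la.

(* The value is 0 when there is no even part. *)
Definition largest_even (la : intpart) : nat := \max_(x <- la | ~~ odd x) x.

Definition mult (la : intpart) (x : nat) : nat := count_mem x la.

Definition EO (la : intpart) : Prop :=
  forall x y, x \in parts la -> y \in parts la -> ~~ odd x -> odd y -> x < y.

Definition EObar (la : intpart) : Prop :=
  EO la /\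
  if has_even la then
    odd (mult la (largest_even la)) /\
    (forall x, x \in parts la -> x != largest_even la -> ~~ odd (mult la x))
  else forall x, x \in parts la -> ~~ odd (mult la x).

Definition eoc (la : intpart) : int :=
  ((largest_even la)%:Z - (num_odd la)%:Z)%R.

(* Main.v *)
Require Import Defs.
From mathcomp Require Import all_boot all_order all_algebra.

(** Write a_i for the parts of la and b_j for those of its conjugate, both
    extended by 0.  Then la is in EObar exactly when there are k and m such
    that a_i is odd iff i < k, b_j is odd iff j < m, a_k = m and b_m = k.  This
    condition is symmetric in la and its conjugate, and it forces k = O(la),
    m = O(la') and m to be the largest even part of la.  The link with
    multiplicities is that x > 0 occurs b_(x-1) - b_x times in la, so that the
    b_j are odd exactly for j < m iff m is the only positive integer of odd
    multiplicity (none if m = 0). *)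

(** [ferrers] tests a part only through comparisons [j < _], so equalities between parts are derived
    from these. *)
Lemma eq_from_ltn (m n : nat) : (forall j, (j < m) = (j < n)) -> m = n.
Proof.
move=> eq_lt; apply/eqP.
by rewrite eqn_leq [m <= n]leqNgt eq_lt ltnn leqNgt -eq_lt ltnn.
Qed.

Lemma nth_conjugate (la : intpart) (j : nat) :
  nth 0 (conjugate la) j = count (fun x => j < x) la.
Proof.
apply: eq_from_ltn => i; have /andP[srt_la _] := intpartP la.
by rewrite count_gt_sorted //; exact: (ferrers_conj la j i).
Qed.

Lemma nth_conjugateK (la : intpart) (i : nat) :
  nth 0 (conjugate (conjugate la)) i = nth 0 la i.
Proof.
apply: eq_from_ltn => j.
exact: etrans (ferrers_conj (conjugate la) i j) (ferrers_conj la j i).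
Qed.

Lemma intpart_gt0 (la : intpart) (x : nat) : x \in parts la -> 0 < x.
Proof.
have /andP[_ la0] := intpartP la.
by case: x => // x0; rewrite x0 in la0.
Qed.

Lemma nth_intpart_le (la : intpart) (i j : nat) :
  i <= j -> nth 0 la j <= nth 0 la i.
Proof.
move=> le_ij; have /andP[srt_la _] := intpartP la.
have [le_j|lt_j] := leqP (size la) j; first by rewrite nth_default.
apply: (sorted_leq_nth (rev_trans leq_trans) (@leqnn) 0 srt_la) => //.
by rewrite inE (leq_ltn_trans le_ij).
Qed.

Lemma nth_conjugate_mult (la : intpart) (j : nat) :
  nth 0 (conjugate la) j = mult la j.+1 + nth 0 (conjugate la) j.+1.
Proof.
rewrite !nth_conjugate /mult -count_predUI.
rewrite [X in _ = _ + X](@eq_count _ _ pred0) ?count_pred0 ?addn0; last first.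
  by move=> x /=; case: eqP => [->|//]; rewrite ltnn.
by apply: eq_count => x /=; rewrite leq_eqVlt eq_sym.
Qed.

Lemma count_odd_nth (s : seq nat) (k : nat) :
  (forall i, odd (nth 0 s i) = (i < k)) -> count odd s = k.
Proof.
elim: s k => [|x s IHs] k odd_s /=.
  by case: k odd_s => // k /(_ 0).
have /= -> := odd_s 0; case: k odd_s => [|k] odd_s.
  by rewrite (IHs 0) // => i; rewrite (odd_s i.+1).
by rewrite (IHs k) // => i; rewrite (odd_s i.+1).
Qed.

(** Induction on [s]: once the head is even, an odd part in the tail would be at most the head by
    sortedness and exceed it by the second hypothesis. If there is no even part, the default value 0
    of [nth] matches the empty maximum. *)
Lemma sorted_EO_nth (s : seq nat) :
    sorted geq s ->
    {in s &, forall x y, ~~ odd x -> odd y -> x < y} ->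
  (forall i, odd (nth 0 s i) = (i < count odd s)) /\
  nth 0 s (count odd s) = \max_(x <- s | ~~ odd x) x.
Proof.
elim: s => [|x s IHs] /=; first by rewrite big_nil; split=> // i; rewrite nth_nil.
rewrite (path_sortedE (rev_trans leq_trans)) => /andP[/allP le_x srt_s] EOs.
have [y z ys zs|IH1 IH2] := IHs srt_s.
  by apply: EOs; rewrite inE ?ys ?zs orbT.
rewrite big_cons; have [ox|ex] /= := boolP (odd x).
  by rewrite add1n; split=> // -[|i] /=; rewrite ?ox ?IH1.
have c0 : count odd s = 0.
  apply/eqP; rewrite -leqn0 leqNgt -has_count; apply/hasPn => y ys.
  apply/negP => oy; have := EOs x y; rewrite !inE eqxx ys orbT.
  by move=> /(_ isT isT ex oy); rewrite ltnNge (le_x y ys : y <= x).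
rewrite c0 in IH1 *; split; first by case=> [|i] /=; rewrite ?(negbTE ex) ?IH1.
apply/esym/maxn_idPl/bigmax_leqP_seq => y ys _; exact: le_x.
Qed.

(** The multiplicity of [x] is odd exactly when the conjugate's entries at [x.-1] and [x] differ in
    parity. *)
Lemma odd_conjugate_mult (la : intpart) (m : nat) :
  (forall j, odd (nth 0 (conjugate la) j) = (j < m)) <->
  (forall x, 0 < x -> odd (mult la x) = (x == m)).
Proof.
split=> [odd_b [//|x] _ | odd_mult j].
  have := nth_conjugate_mult la x; move/(congr1 odd); rewrite oddD !odd_b.
  by case: (ltngtP x.+1 m); case: (odd _).
(* Descending induction on [j]: beyond both bounds the entry is the default 0, hence even, and
   [j < m] fails. *)
suff odd_b d : forall j, maxn (size (conjugate la)) m <= j + d ->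
    odd (nth 0 (conjugate la) j) = (j < m).
  by apply: (odd_b (maxn (size (conjugate la)) m)); rewrite leq_addl.
elim: d => [|d IHd] {}j.
  by rewrite addn0 geq_max => /andP[? le_mj]; rewrite nth_default // ltnNge le_mj.
rewrite -addSnnS => /IHd odd_b; rewrite nth_conjugate_mult oddD odd_b odd_mult //.
by case: (ltngtP j.+1 m).
Qed.

Lemma largest_even_mem (la : intpart) :
  has_even la -> largest_even la \in parts la /\ ~~ odd (largest_even la).
Proof.
rewrite /has_even /largest_even; case: la => s /= _.
elim: s => //= x s IHs; rewrite big_cons inE; have [ox|ex] /= := boolP (odd x).
  by move=> /IHs[-> ->]; rewrite orbT.
move=> _; have [hs|nhs] := boolP (has (fun x => ~~ odd x) s).
  have [ms em] := IHs hs.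
  by rewrite /maxn; case: ifP => _; rewrite ?ms ?em ?eqxx ?ex ?orbT.
by rewrite big_hasC // maxn0 eqxx.
Qed.

Lemma largest_even0 (la : intpart) : ~~ has_even la -> largest_even la = 0.
Proof. by move=> ?; rewrite /largest_even big_hasC. Qed.

(* [k] and [m] are the numbers of odd parts of [la] and of its conjugate. *)
Definition parity_pattern (la : intpart) (k m : nat) : Prop :=
  [/\ forall i, odd (nth 0 la i) = (i < k),
      forall j, odd (nth 0 (conjugate la) j) = (j < m),
      nth 0 la k = m & nth 0 (conjugate la) m = k].

Lemma parity_pattern_conj (la : intpart) (k m : nat) :
  parity_pattern la k m -> parity_pattern (conjugate la) m k.
Proof. by case=> a b c d; split=> // [j|]; rewrite nth_conjugateK. Qed.

Lemma parity_pattern_conjK (la : intpart) (k m : nat) :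
  parity_pattern (conjugate la) m k -> parity_pattern la k m.
Proof.
by case=> a b c d; split=> // [i|]; rewrite -nth_conjugateK.
Qed.

Lemma parity_pattern_num_odd (la : intpart) (k m : nat) :
  parity_pattern la k m -> num_odd la = k.
Proof. by case=> odd_a _ _ _; exact: count_odd_nth. Qed.

(** Odd parts sit at earlier indices than even ones, so they are at least as large, and parity makes
    the inequality strict. *)
Lemma parity_pattern_EO (la : intpart) (k m : nat) :
  parity_pattern la k m -> EO la.
Proof.
case=> odd_a _ _ _ x y /(nthP 0)[i _ <-] /(nthP 0)[j _ <-].
rewrite !odd_a -leqNgt => le_ki lt_jk.
have le_ij := nth_intpart_le la j i (ltnW (leq_trans lt_jk le_ki)).
rewrite ltn_neqAle le_ij andbT; apply/eqP => /(congr1 odd).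
by rewrite !odd_a lt_jk ltnNge le_ki.
Qed.

Lemma parity_pattern_largest_even (la : intpart) (k m : nat) :
  parity_pattern la k m -> largest_even la = m.
Proof.
move=> pat; have EOla := @parity_pattern_EO _ _ _ pat.
have /andP[srt_la _] := intpartP la.
have [x y xs ys|_ a_k] := sorted_EO_nth (parts la) srt_la; first exact: EOla.
rewrite /largest_even -a_k; have := @parity_pattern_num_odd _ _ _ pat; rewrite /num_odd => ->.
by case: pat.
Qed.

Lemma parity_pattern_EObar (la : intpart) (k m : nat) :
  parity_pattern la k m -> EObar la.
Proof.
move=> pat; split; first exact: parity_pattern_EO pat.
have := @parity_pattern_largest_even _ _ _ pat.
have [_ /odd_conjugate_mult odd_mult _ _] := pat.
case: ifPn => [he|/largest_even0-> m0].
  move=> Dm; rewrite Dm; have [/intpart_gt0] := largest_even_mem la he.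
  rewrite Dm => m_gt0 _; split=> [|x /intpart_gt0 x_gt0 x_m].
    by rewrite odd_mult ?eqxx.
  by rewrite odd_mult.
by move=> x /intpart_gt0 x_gt0; rewrite odd_mult // -m0 -lt0n.
Qed.

Lemma EObar_parity_pattern (la : intpart) :
  EObar la -> parity_pattern la (num_odd la) (largest_even la).
Proof.
case=> EOla mult_la; have /andP[srt_la _] := intpartP la.
have [x y xs ys|odd_a a_k] := sorted_EO_nth (parts la) srt_la; first exact: EOla.
rewrite -/(largest_even la) -/(num_odd la) in odd_a a_k.
split=> //.
  apply/odd_conjugate_mult => x x_gt0.
  have [xs|xNs] := boolP (x \in parts la); last first.
    (* If [x] were the largest even part, being positive it would occur in [la]. *)
    rewrite /mult (count_memPn xNs) /=; apply/esym/negbTE.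
    apply: contra xNs => /eqP Dx; rewrite Dx in x_gt0 *.
    case: (boolP (has_even la)) => [/largest_even_mem[]//|/largest_even0 m0].
    by rewrite m0 in x_gt0.
  move: mult_la; case: ifPn => [_ [odd_m even_x]|/largest_even0-> even_x].
    by have [->|/even_x/negbTE->] := eqVneq x (largest_even la).
  by rewrite (negbTE (even_x x xs)); case: x x_gt0 {xs}.
(* It remains to see that the parts exceeding the largest even part are those at indices below
   [num_odd la]. There the part is odd and at least the even part at index [num_odd la], hence
   larger. *)
apply: eq_from_ltn => i; rewrite [LHS](ferrers_conj la (largest_even la) i).
rewrite /ferrers -a_k; have [lt_ik|le_ki] := ltnP i (num_odd la); last first.
  by apply/negbTE; rewrite -leqNgt nth_intpart_le.
rewrite ltn_neqAle (nth_intpart_le _ _ _ (ltnW lt_ik)) andbT.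
by apply/eqP => /(congr1 odd); rewrite !odd_a lt_ik ltnn.
Qed.

Theorem mainTheorem1 (la : intpart) :
  (EObar la <-> EObar (conjugate la)) /\
  (EObar la ->
     eoc la = ((num_odd (conjugate la))%:Z - (num_odd la)%:Z)%R /\
     ((num_odd (conjugate la))%:Z - (num_odd la)%:Z)%R = (- srank la)%R).
Proof.
split.
  split=> /EObar_parity_pattern pat.
    exact: parity_pattern_EObar (parity_pattern_conj _ _ _ pat).
  exact: parity_pattern_EObar (parity_pattern_conjK _ _ _ pat).
(* Counting the odd parts in the pattern of the conjugate identifies the largest even part of [la]
   with [num_odd (conjugate la)]. *)
move=> /EObar_parity_pattern/parity_pattern_conj/parity_pattern_num_odd Dm.
by split; [rewrite Dm | rewrite /srank GRing.opprB].
Qed.
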